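(* Let $1<p<\infty$, let $M$ be a nonempty subset of $\mathbb{N}$, let $r>0$, and let $r\mathbb{C}_M=\{x\in l_p:\|x_M\|_p\le r\}$ be the closed and convex cylinder in $l_p$, with interior $(r\mathbb{C}_M)^o$ and metric projection $P_{r\mathbb{C}_M}:l_p\to r\mathbb{C}_M$. For $\bar{x}\in l_p$ with $\bar{y}=P_{r\mathbb{C}_M}(\bar{x})$, the covering constant of $P_{r\mathbb{C}_M}$ at $(\bar{x},\bar{y})$ satisfies: (a) $\hat{\alpha}(P_{r\mathbb{C}_M},\bar{x},\bar{y})=1$ for any $\bar{x}\in(r\mathbb{C}_M)^o$; (b) $\hat{\alpha}(P_{r\mathbb{C}_M},\bar{x},\bar{y})=0$ for any $\bar{x}\in l_p\setminus(r\mathbb{C}_M)^o$.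
   Context: $(l_p,\|\cdot\|_p)$ is the real Banach space of $p$-summable real sequences indexed by the positive integers $\mathbb{N}$, with dual $(l_q,\|\cdot\|_q)$, $\frac1p+\frac1q=1$, and duality pairing $\langle\cdot,\cdot\rangle$. For nonempty $M\subseteq\mathbb{N}$ and $x=(x_1,x_2,\ldots)\in l_p$, $x_M\in l_p$ is the sequence with $(x_M)_i=x_i$ for $i\in M$ and $(x_M)_i=0$ for $i\notin M$. $\mathbb{B}(c,\eta)$ denotes the closed ball in $l_p$ with center $c$ and radius $\eta$. For a nonempty closed convex $C\subset l_p$, the metric projection $P_C:l_p\to C$ is the (single-valued, continuous) map such that $\|x-P_C(x)\|_p\le\|x-z\|_p$ for all $z\in C$. The Mordukhovich derivative (coderivative) of $P_C$ at $(x,y)$ with $y=P_C(x)$ is the set-valued map $\widehat{D}^*P_C(x,y):l_q\rightrightarrows l_q$ given by $$\widehat{D}^*P_C(x,y)(w^* )=\left\{z^*\in l_q:\limsup_{u\to x}\frac{\langle z^*,u-x\rangle-\langle w^*,P_C(u)-P_C(x)\rangle}{\|u-x\|_p+\|P_C(u)-P_C(x)\|_p}\le 0\right\}.$$ For $\bar{y}=P_C(\bar{x})$, the covering constant of $P_C$ at $(\bar{x},\bar{y})$ is $$\hat{\alpha}(P_C,\bar{x},\bar{y})=\sup_{\eta>0}\inf\{\|z^*\|_q: z^*\in\widehat{D}^*P_C(x,y)(w^* ),\ x\in\mathbb{B}(\bar{x},\eta),\ y=P_C(x)\in\mathbb{B}(\bar{y},\eta),\ w^*\in l_q,\ \|w^*\|_q=1\}.$$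 *)

(* Defs.v *)
From HB Require Import structures.
From mathcomp Require Import all_boot all_order all_algebra.
From mathcomp Require Import all_classical all_reals all_analysis.
From mathcomp Require ess_sup_inf.

Set Implicit Arguments.
Unset Strict Implicit.
Unset Printing Implicit Defensive.
Import Order.TTheory GRing.Theory Num.Theory.
Import numFieldNormedType.Exports.
Local Open Scope classical_set_scope.
Local Open Scope ring_scope.

(* Sequences are indexed from 0: the positive integer i of the paper is the
   natural number i - 1. *)
Definition lp (R : realType) (p : \bar R) (p1 : (1 <= p)%E) : Type :=
  LfunType (@counting nat R) p1.

Definition lp_fun (R : realType) (p : \bar R) (p1 : (1 <= p)%E) (x : lp p1) :
  LfunType (@counting nat R) p1 := x.
Coercion lp_fun : lp >-> LfunType.

Section lp_normed.
Context (R : realType) (p : \bar R) (p1 : (1 <= p)%E).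
Local Notation E := (lp p1).

HB.instance Definition _ := GRing.Lmodule.copy E (LfunType (@counting nat R) p1).

Definition lp_norm (x : E) : R := fine 'N[@counting nat R]_p[EFin \o x]%E.

Lemma ler_lp_normD (x y : E) : lp_norm (x + y) <= lp_norm x + lp_norm y.
Proof. exact: (@ler_LnormD _ _ _ (@counting nat R) p p1 x y). Qed.

Lemma lp_normZ (a : R) (x : E) : lp_norm (a *: x) = `|a| * lp_norm x.
Proof.
apply: EFin_inj; rewrite EFinM /lp_norm.
rewrite !(@finite_norm_fine _ _ _ (@counting nat R) p p1).
exact: (@LnormZ _ _ _ (@counting nat R) p p1 x a).
Qed.

Lemma lp_norm_eq0 (x : E) : lp_norm x = 0 -> x = 0.
Proof.
move=> /(@fine_Lnormr_eq0 _ _ _ (@counting nat R) p p1) [N [_ N0 xN]].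
apply/(@LfuneqP _ _ _ (@counting nat R) p p1) => i.
apply: contrapT => xi0; move: N0.
have Ni : N i by apply: xN => /= /(_ I).
suff : (1%:E <= @counting nat R N)%E by move=> + N0; rewrite N0 lee_fin ler10.
rewrite /counting; case: asboolP => [finN|]; last by rewrite leey.
rewrite lee_fin (ler_nat R 1) finmap.cardfs_gt0; apply/finmap.fset0Pn.
by exists i; rewrite in_fset_set// inE.
Qed.

HB.instance Definition _ :=
  @Lmodule_isNormed.Build R E lp_norm ler_lp_normD lp_normZ lp_norm_eq0.

End lp_normed.

Lemma lp_normE (R : realType) (p : R) (p1 : (1 <= p%:E)%E) (x : lp p1) :
  (`|x|%:E = (\sum_(k <oo) (`|x k| `^ p)%:E) `^ p^-1)%E.
Proof.
rewrite [X in (X%:E)%E](_ : `|x| = lp_norm x)//.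
rewrite /lp_norm (@finite_norm_fine _ _ _ (@counting nat R) p%:E p1).
by rewrite Lnorm_counting// (lt_le_trans ltr01)// -lee_fin.
Qed.

Section restriction.
Context (R : realType) (p : \bar R) (p1 : (1 <= p)%E).
Variables (M : set nat) (x : lp p1).

Definition restr_fun : nat -> R := fun i => if i \in M then x i else 0.

Lemma restr_funP : restr_fun \in @Lfun _ _ R (@counting nat R) p.
Proof.
rewrite inE; apply/andP; split; rewrite inE//=.
have le i : (`|(EFin \o restr_fun) i| <= `|(EFin \o x) i|)%E.
  by rewrite /= /restr_fun; case: ifP => //; rewrite normr0 lee_fin.
have := @Lfunction_finite _ _ _ (@counting nat R) p p1 x.
rewrite /finite_norm => /=; apply: le_lt_trans.
rewrite unlock /Lnorm; move: restr_fun le => g; case: p p1 x => [s s1|y1|//] y le.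
- have s0 : 0 <= s by rewrite (le_trans ler01)// -lee_fin.
  apply: gt0_ler_poweR; rewrite ?invr_ge0// ?in_itv/= ?leey ?andbT.
  + by apply: integral_ge0 => i _; rewrite lee_fin powR_ge0.
  + by apply: integral_ge0 => i _; rewrite lee_fin powR_ge0.
  apply: ge0_le_integral => // i _.
  by rewrite lee_fin ge0_ler_powR ?nnegrE// -lee_fin; exact: le.
- by case: ifPn => // _; apply: ess_sup_inf.le_ess_sup; exact: nearW.
Qed.

Definition restr : lp p1 := Lfun_Sub p1 restr_funP.

End restriction.

Notation dual_lp p1 := (lp (hoelder_conj_ge1 p1)).

Section covering_constant.
Context (R : realType) (p : \bar R) (p1 : (1 <= p)%E).
Local Notation E := (lp p1).
Local Notation E' := (dual_lp p1).

Definition pairing (z : E') (x : E) : R :=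
  limn (series (fun k => z k * x k)).

Definition cylinder (M : set nat) (r : R) : set E :=
  [set x | `|restr M x| <= r].

(* When x has no nearest point in C the value is irrelevant; for 1 < p < +oo
   and C nonempty, closed and convex there is exactly one nearest point. *)
Definition metric_proj (C : set E) (x : E) : E :=
  get [set y | C y /\ forall z, C z -> `|x - y| <= `|x - z|].

(* Empty unless (x, y) is in the graph of f. *)
Definition coderivative (f : E -> E) (x y : E) (w : E') : set E' :=
  [set z | y = f x /\
    (limf_esup (fun u : E =>
       ((pairing z (u - x) - pairing w (f u - f x)) /
        (`|u - x| + `|f u - f x|))%:E) (x^') <= 0)%E].

Definition covering_constant (f : E -> E) (xbar ybar : E) : \bar R :=
  ereal_sup [set ereal_inf
    [set e | exists (x y : E) (w z : E'),
       [/\ closed_ball xbar eta x, y = f x /\ closed_ball ybar eta y,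
           `|w| = 1, coderivative f x y w z & e = `|z|%:E]]
    | eta in [set eta : R | 0 < eta]].

End covering_constant.

(* Main.v *)
Require Import Defs.
From mathcomp Require Import all_boot all_order all_algebra.
From mathcomp Require Import all_classical all_reals all_analysis.
From mathcomp Require Import ring lra.
Set Implicit Arguments.
Unset Strict Implicit.
Unset Printing Implicit Defensive.
Import Order.TTheory GRing.Theory Num.Theory.
Import numFieldNormedType.Exports.
Local Open Scope classical_set_scope.
Local Open Scope ring_scope.

(** Over the interior of the cylinder the projection P is locally the identity.
A regular coderivative of the identity at w can only be w itself, as testing
along the unit vectors shows ([coderivative_near_id_eq]), so both norms agree
and the covering constant is 1 ([covering_constant_near_id]).

When xbar is not interior, the point y = P xbar lies on the boundary: its part
y_M has norm exactly r. The ball of radius r then has a supporting functional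
at y_M, that is, some w of norm 1, vanishing outside M, such that <w, c - y> is
nonnegative for every c in the cylinder ([supporting_functional]). Every value
of P lies in the cylinder, so the numerator <0, u - xbar> - <w, P u - P xbar>
is nonpositive for every u: the functional 0 belongs to the coderivative at w,
at the very point (xbar, y). All the infima defining the covering constant
therefore vanish ([covering_constant_supported]).

That nearest points exist and that |y_M| = r both come from one explicit nearest
point, obtained by shrinking x_M to norm r ([cylinder_nearest]): it realizes the
distance |x_M| - r, and a point whose part inside M has norm less than r is
farther away.

The supporting functional is the normalized opposite of the duality map
J v = (sgn v_k |v_k|^(s-1))_k. That J v supports the ball at v is the convexity
inequality s J_k (b - v_k) <= |b|^s - |v_k|^s, an instance of Young's inequality
([duality_seq_young]), summed over k. *)

(** * The norm of a summable sequence as a limit of partial sums *)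

Lemma lp_powR_series_cvg (R : realType) (s : R) (p1 : (1 <= s%:E)%E) (x : lp p1) :
  series (fun k => `|x k| `^ s) @ \oo --> `|x| `^ s.
Proof.
have s0 : 0 < s by rewrite (lt_le_trans ltr01)// -lee_fin.
have xE : ((`|x| `^ s)%:E = \sum_(k <oo) (`|x k| `^ s)%:E)%E.
  rewrite -poweR_EFin lp_normE -poweRrM mulVf ?gt_eqF// poweRe1//.
  by apply: nneseries_ge0 => k _ _; rewrite lee_fin powR_ge0.
have : ((fun n => \sum_(0 <= k < n) (`|x k| `^ s)%:E) @ \oo --> (`|x| `^ s)%:E)%E.
  rewrite xE; apply: is_cvg_nneseries => k _ _.
  by rewrite lee_fin powR_ge0.
move=> /fine_cvgP[_]; apply: cvg_trans.
apply: near_eq_cvg; near=> n.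
by rewrite /= sumEFin.
Unshelve. all: end_near. Qed.

Lemma lp_powR_series_le (R : realType) (s : R) (p1 : (1 <= s%:E)%E) (x : lp p1) n :
  series (fun k => `|x k| `^ s) n <= `|x| `^ s.
Proof.
rewrite -(cvg_lim _ (@lp_powR_series_cvg _ _ p1 x))//.
apply: nondecreasing_cvgn_le; last first.
  by apply/cvg_ex; eexists; exact: lp_powR_series_cvg.
by apply: nondecreasing_series => k _ _; exact: powR_ge0.
Qed.

(** Measurability is automatic for the counting measure, so membership reduces
to a bound on the partial sums. *)
Lemma mem_Lfun_counting (R : realType) (s B : R) (f : nat -> R) : 0 < s ->
  (forall n, series (fun k => `|f k| `^ s) n <= B) ->
  f \in Lfun (@counting nat R) s%:E.
Proof.
move=> s0 fB; rewrite inE; apply/andP; split; rewrite inE//=.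
rewrite /finite_norm Lnorm_counting//; apply: poweR_lty.
apply: (@le_lt_trans _ _ B%:E); last exact: ltry.
apply: lime_le.
  by apply: is_cvg_nneseries => k _ _; exact: poweR_ge0.
by near=> n; rewrite /= sumEFin lee_fin; exact: fB.
Unshelve. all: end_near. Qed.

Lemma ler_lp_norm (R : realType) (s : R) (p1 : (1 <= s%:E)%E) (x y : lp p1) :
  (forall i, `|x i| <= `|y i|) -> `|x| <= `|y|.
Proof.
move=> xy; have s0 : 0 < s by rewrite (lt_le_trans ltr01)// -lee_fin.
rewrite leNgt; apply/negP => yx.
have : `|y| `^ s < `|x| `^ s by apply: gt0_ltr_powR; rewrite ?nnegrE.
rewrite ltNge => /negP; apply.
apply: (ler_cvg_to (@lp_powR_series_cvg _ _ _ x) (@lp_powR_series_cvg _ _ _ y)).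
near=> n; apply: ler_sum => k _.
by rewrite ge0_ler_powR ?nnegrE ?(ltW s0).
Unshelve. all: end_near. Qed.

(** * Restriction of a sequence to a set of indices *)

Lemma lpDE (R : realType) (p : \bar R) (p1 : (1 <= p)%E) (x y : lp p1) i :
  (x + y) i = x i + y i.
Proof. by []. Qed.

Lemma lpZE (R : realType) (p : \bar R) (p1 : (1 <= p)%E) a (x : lp p1) i :
  (a *: x) i = a * x i.
Proof. by []. Qed.

Lemma lpBE (R : realType) (p : \bar R) (p1 : (1 <= p)%E) (x y : lp p1) i :
  (x - y) i = x i - y i.
Proof. by []. Qed.

Lemma restrE (R : realType) (p : \bar R) (p1 : (1 <= p)%E) (M : set nat) (x : lp p1) i :
  restr M x i = if i \in M then x i else 0.
Proof. by []. Qed.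

Lemma restrD (R : realType) (p : \bar R) (p1 : (1 <= p)%E) (M : set nat) (x y : lp p1) :
  restr M (x + y) = restr M x + restr M y.
Proof.
by apply/LfuneqP => i; rewrite lpDE !restrE; case: ifP => //; rewrite addr0.
Qed.

Lemma restrZ (R : realType) (p : \bar R) (p1 : (1 <= p)%E) (M : set nat) a (x : lp p1) :
  restr M (a *: x) = a *: restr M x.
Proof.
by apply/LfuneqP => i; rewrite lpZE !restrE; case: ifP => //; rewrite mulr0.
Qed.

Lemma restrB (R : realType) (p : \bar R) (p1 : (1 <= p)%E) (M : set nat) (x y : lp p1) :
  restr M (x - y) = restr M x - restr M y.
Proof. by rewrite -scaleN1r restrD restrZ scaleN1r. Qed.

Lemma restr_id (R : realType) (p : \bar R) (p1 : (1 <= p)%E) (M : set nat) (x : lp p1) :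
  restr M (restr M x) = restr M x.
Proof. by apply/LfuneqP => i; rewrite !restrE; case: ifP => // ->. Qed.

Lemma norm_restr_le (R : realType) (s : R) (p1 : (1 <= s%:E)%E) (M : set nat)
  (x : lp p1) : `|restr M x| <= `|x|.
Proof.
by apply: ler_lp_norm => i; rewrite restrE; case: ifP => // _; rewrite normr0.
Qed.

(** * Upper limits along a filter *)

Lemma limf_esup_le (T : choiceType) (X : filteredType T) (R : realType)
  (f : X -> \bar R) (F : set_system X) (a : \bar R) :
  (\forall u \near F, (f u <= a)%E) -> (limf_esup f F <= a)%E.
Proof.
move=> fa; rewrite limf_esupE; apply: ge_ereal_inf.
exists (ereal_sup (f @` [set u | (f u <= a)%E])); first by exists [set u | (f u <= a)%E].
by apply: ge_ereal_sup => _ [u ua <-].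
Qed.

Lemma limf_esup_lt (T : choiceType) (X : filteredType T) (R : realType)
  (f : X -> \bar R) (F : set_system X) (a : \bar R) : Filter F ->
  (limf_esup f F < a)%E -> \forall u \near F, (f u < a)%E.
Proof.
move=> FF; rewrite limf_esupE => /ereal_inf_lt[_ [V FV <-]] Va.
apply: filterS FV => u Vu; apply: le_lt_trans Va.
by apply: ereal_sup_ubound; exists u.
Qed.

(** * The duality pairing *)

Lemma hoelder_conjugate_EFin (R : realType) (s : R) : 1 < s ->
  hoelder_conjugate s%:E = (s / (s - 1))%:E.
Proof.
move=> s1; rewrite /hoelder_conjugate/= eqe gt_eqF ?(lt_trans ltr01)//.
by rewrite -EFinB inver subr_eq0 gt_eqF.
Qed.

(** The exponent is left as an extended real so as to apply to the dual space,
whose exponent is only provably a real number. *)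
Lemma is_cvg_lp_powR_series (R : realType) (t : R) (q : \bar R) (q1 : (1 <= q)%E)
  (z : lp q1) : q = t%:E -> cvgn (series (fun k => `|z k| `^ t)).
Proof.
move=> qt; move: q1 z; rewrite qt => q1 z.
by apply/cvg_ex; eexists; exact: lp_powR_series_cvg.
Qed.

(** Young's inequality dominates each term by |x_k|^s / s + |z_k|^q / q. *)
Lemma is_cvg_pairing (R : realType) (s : R) (s1 : 1 < s) (p1 : (1 <= s%:E)%E)
  (z : dual_lp p1) (x : lp p1) : cvgn (series (fun k => z k * x k)).
Proof.
have s0 : 0 < s by rewrite (lt_trans ltr01).
have q0 : 0 < s / (s - 1) by rewrite divr_gt0// subr_gt0.
apply: normed_cvg.
apply: (@series_le_cvg _ _ ((s / (s - 1))^-1 *: (fun k => `|z k| `^ (s / (s - 1)))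
   + s^-1 *: (fun k => `|x k| `^ s))) => [n|n|n|].
- exact: normr_ge0.
- by rewrite addr_ge0// mulr_ge0 ?invr_ge0 ?powR_ge0// ltW.
- rewrite /= normrM [leRHS]addrC mulrC; apply: le_trans.
    apply: (@conjugate_powR _ `|x n| `|z n| s (s / (s - 1))) => //.
    by field; rewrite subr_eq0 !gt_eqF.
  by rewrite le_eqVlt; apply/orP; left; apply/eqP; congr (_ + _); rewrite mulrC.
- apply: is_cvg_seriesD; apply: is_cvg_seriesZ.
    by apply: is_cvg_lp_powR_series; exact: hoelder_conjugate_EFin.
  exact: is_cvg_lp_powR_series.
Qed.

Lemma pairing0 (R : realType) (p : \bar R) (p1 : (1 <= p)%E) (x : lp p1) :
  pairing (0 : dual_lp p1) x = 0.
Proof.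
rewrite /pairing (_ : series _ = cst 0); first exact: lim_cst.
apply/funext => n; rewrite /series/=.
by apply: big1 => k _; rewrite mul0r.
Qed.

Lemma pairingZl (R : realType) (s : R) (s1 : 1 < s) (p1 : (1 <= s%:E)%E) a
  (z : dual_lp p1) (x : lp p1) : pairing (a *: z) x = a * pairing z x.
Proof.
rewrite /pairing -[RHS]lim_seriesZ; last exact: is_cvg_pairing.
congr (limn (series _)); apply/funext => k.
by rewrite lpZE /= -mulrA.
Qed.

Lemma unit_seq_Lfun (R : realType) (t : R) (i : nat) : 0 < t ->
  (fun k => (k == i)%:R : R) \in Lfun (@counting nat R) t%:E.
Proof.
move=> t0; apply: (@mem_Lfun_counting _ t 1) => // n.
rewrite /series/= (eq_bigr (fun k => if k == i then 1 else 0)); last first.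
  by move=> k _; case: eqP => _; rewrite ?normr1 ?powR1 ?normr0 ?powR0 ?gt_eqF.
by rewrite -big_mkcond big_nat1_eq; case: ifP.
Qed.

(** Stated for a sequence x known by its values, so that it applies to any
presentation of the multiples of the unit vectors. *)
Lemma pairing_unit (R : realType) (p : \bar R) (p1 : (1 <= p)%E) (z : dual_lp p1)
  (x : lp p1) a i : (forall k, x k = a * (k == i)%:R) -> pairing z x = a * z i.
Proof.
move=> xE; rewrite /pairing; apply: lim_near_cst => //.
near=> n; rewrite /series/=.
rewrite (eq_bigr (fun k => if k == i then a * z i else 0)); last first.
  by move=> k _; rewrite xE; case: eqP => [->|]; rewrite ?mulr1 ?mulr0 // mulrC.
rewrite -big_mkcond big_nat1_eq ifT//=.
by near: n; exact: nbhs_infty_gt.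
Unshelve. all: end_near. Qed.

Lemma pairing_restr (R : realType) (p : \bar R) (p1 : (1 <= p)%E) (M : set nat)
    (w : dual_lp p1) (x : lp p1) :
  (forall k, k \notin M -> w k = 0) -> pairing w (restr M x) = pairing w x.
Proof.
move=> wM; congr (limn (series _)); apply/funext => k.
by rewrite restrE; case: ifPn => // /wM ->; rewrite !mul0r.
Qed.

(** * Supporting functionals of the ball *)

(** The gradient of |v|^s / s, a positive multiple of the duality map of the
s-norm. *)
Definition duality_seq (R : realType) (s : R) (v : nat -> R) : nat -> R :=
  fun k => Num.sg (v k) * `|v k| `^ (s - 1).

(** The powers match because (s - 1) q = s: the q-norm of J v is |v|^(s-1). *)
Lemma duality_seq_Lfun (R : realType) (s : R) (p1 : (1 <= s%:E)%E) (v : lp p1) :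
  1 < s -> duality_seq s v \in Lfun (@counting nat R) (hoelder_conjugate s%:E).
Proof.
move=> s1; have s0 : 0 < s by rewrite (lt_trans ltr01).
have q0 : 0 < s / (s - 1) by rewrite divr_gt0// subr_gt0.
rewrite hoelder_conjugate_EFin//; apply: (@mem_Lfun_counting _ _ (`|v| `^ s)) => // n.
apply: le_trans (lp_powR_series_le v n); apply: ler_sum => k _.
rewrite /duality_seq normrM normr_sg.
have [->|vk] := eqVneq (v k) 0; first by rewrite mul0r normr0 !powR0 ?gt_eqF.
rewrite mul1r ger0_norm ?powR_ge0// -powRrM.
by rewrite [(s - 1) * _]mulrC divfK// subr_eq0 gt_eqF.
Qed.

(** The graph of the convex function b |-> |b|^s lies above its tangent at v_k.
The proof is Young's inequality for |b| and |v_k|^(s-1). *)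
Lemma duality_seq_young (R : realType) (s : R) (v : nat -> R) (b : R) k : 1 < s ->
  s * (duality_seq s v k * (b - v k)) <= `|b| `^ s - `|v k| `^ s.
Proof.
move=> s1; have s0 : 0 < s by rewrite (lt_trans ltr01).
have q0 : 0 < s / (s - 1) by rewrite divr_gt0// subr_gt0.
rewrite /duality_seq; set a := v k; set A := `|a| `^ (s - 1).
have AE : A `^ (s / (s - 1)) = `|a| `^ s.
  by rewrite -powRrM mulrC divfK// subr_eq0 gt_eqF.
have aA : Num.sg a * A * a = `|a| `^ s.
  by rewrite -mulrA [A * a]mulrC mulrA -normrEsg mulr_powRB1.
have := @conjugate_powR _ `|b| A s _ (normr_ge0 _) (powR_ge0 _ _) s0 q0.
rewrite AE => /(_ _)/wrap[|young]; first by field; rewrite subr_eq0 !gt_eqF.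
have bA : Num.sg a * A * b <= `|b| * A.
  rewrite mulrAC ler_wpM2r ?powR_ge0// (le_trans (ler_norm _))// normrM normr_sg.
  by case: (a != 0); rewrite ?mul1r ?mul0r.
rewrite mulrBr aA.
have : s * (`|b| * A) <= `|b| `^ s + (s - 1) * `|a| `^ s.
  apply: le_trans (ler_wpM2l (ltW s0) young) _.
  rewrite le_eqVlt; apply/orP; left; apply/eqP; field.
  by rewrite subr_eq0 !gt_eqF.
have := ler_wpM2l (ltW s0) bA.
by rewrite mulrBr; lra.
Qed.

(** Summing the tangent inequality gives s <J v, c - v> <= |c|^s - |v|^s <= 0.
The sign is reversed because the coderivative needs a functional that is minimal
at v over the ball. The support condition is what lets a functional built from
the part of a point inside M act on whole sequences. *)
Lemma supporting_functional (R : realType) (s : R) (s1 : 1 < s) (p1 : (1 <= s%:E)%E)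
  (v : lp p1) : v != 0 ->
  exists w : dual_lp p1, [/\ `|w| = 1, forall k, v k = 0 -> w k = 0 &
    forall c : lp p1, `|c| <= `|v| -> 0 <= pairing w (c - v)].
Proof.
move=> v0; have s0 : 0 < s by rewrite (lt_trans ltr01).
pose J : dual_lp p1 := Lfun_Sub (hoelder_conj_ge1 p1) (duality_seq_Lfun v s1).
have JE k : J k = duality_seq s v k by [].
have J0 : J != 0.
  apply: contra v0 => /eqP J0; apply/eqP/LfuneqP => k.
  have : duality_seq s v k = 0 by rewrite -JE J0.
  move=> /eqP; rewrite mulf_eq0 sgr_eq0 powR_eq0 normr_eq0 => vk.
  by apply/eqP; case/orP: vk => // /andP[].
exists (- `|J|^-1 *: J); split.
- by rewrite normrZ normrN normfV normr_id mulVf// normr_eq0.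
- by move=> k vk0; rewrite lpZE JE /duality_seq vk0 sgr0 mul0r mulr0.
move=> c cv; rewrite pairingZl// mulNr oppr_ge0 mulr_ge0_le0 ?invr_ge0//.
rewrite -(pmulr_rle0 _ s0).
have : `|c| `^ s - `|v| `^ s <= 0.
  by rewrite subr_le0 ge0_ler_powR ?nnegrE// ltW.
apply: le_trans.
have h1 : series (fun k => `|c k| `^ s) n - series (fun k => `|v k| `^ s) n
    @[n --> \oo] --> `|c| `^ s - `|v| `^ s.
  by apply: cvgB; exact: lp_powR_series_cvg.
have h2 : s * series (fun k => J k * (c - v) k) n @[n --> \oo] --> s * pairing J (c - v).
  by apply: cvgMr; exact: is_cvg_pairing.
apply: (ler_cvg_to h2 h1).
near=> n; rewrite /= /series/= mulr_sumr -sumrB; apply: ler_sum => k _.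
exact: duality_seq_young.
Unshelve. all: end_near. Qed.

(** * Nearest points of the cylinder *)

Lemma metric_proj_id (R : realType) (p : \bar R) (p1 : (1 <= p)%E) (C : set (lp p1)) x :
  C x -> metric_proj C x = x.
Proof.
move=> Cx; have : exists y, C y /\ forall z, C z -> `|x - y| <= `|x - z|.
  by exists x; split=> // z _; rewrite subrr normr0.
move=> /getPex[_ /(_ x Cx)]; rewrite subrr normr0 normr_le0 subr_eq0 => /eqP xE.
by rewrite {2}xE.
Qed.

(** The witness shrinks the part of x inside M to norm r and leaves the rest
alone. It is optimal because restricting to M does not increase norms: every z of
the cylinder satisfies |x - z| >= |x_M - z_M| >= |x_M| - r. *)
Lemma cylinder_nearest (R : realType) (s : R) (p1 : (1 <= s%:E)%E) (M : set nat)
  (r : R) (x : lp p1) : 0 < r -> r <= `|restr M x| ->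
  exists y, [/\ cylinder M r y, `|x - y| = `|restr M x| - r &
   forall z, cylinder M r z -> `|x - y| <= `|x - z|].
Proof.
move=> r0 rx; have x0 : 0 < `|restr M x| := lt_le_trans r0 rx.
set a := r / `|restr M x|.
have xyE : `|x - (x - (1 - a) *: restr M x)| = `|restr M x| - r.
  rewrite opprB addrC subrK normrZ ger0_norm; last first.
    by rewrite subr_ge0 /a ler_pdivrMr// mul1r.
  by rewrite mulrBl mul1r /a divfK// gt_eqF.
exists (x - (1 - a) *: restr M x); split=> //.
- rewrite /cylinder/= restrB restrZ restr_id -[X in X - _]scale1r.
  rewrite -scalerBl opprB addrC subrK.
  by rewrite normrZ ger0_norm /a ?divr_ge0 ?(ltW x0) ?(ltW r0)// divfK// gt_eqF.
- move=> z; rewrite /cylinder/= => zr; rewrite xyE.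
  apply: le_trans (norm_restr_le M _); rewrite restrB.
  by apply: le_trans (lerB_dist _ _); rewrite lerB.
Qed.

Lemma metric_proj_cylinderP (R : realType) (s : R) (p1 : (1 <= s%:E)%E) (M : set nat)
  (r : R) (x : lp p1) : 0 < r -> let y := metric_proj (cylinder M r) x in
  cylinder M r y /\ forall z, cylinder M r z -> `|x - y| <= `|x - z|.
Proof.
move=> r0; have [xr|/ltW rx] := leP `|restr M x| r.
  by rewrite /= metric_proj_id//; split=> // z _; rewrite subrr normr0.
have [y [Cy _ yP]] := cylinder_nearest r0 rx.
by apply: (@getPex _ [set y | cylinder M r y /\ _]); exists y.
Qed.

(** A nearest point is at distance |x_M| - r from x, so its part inside M cannot
have norm less than r. *)
Lemma norm_restr_metric_proj (R : realType) (s : R) (p1 : (1 <= s%:E)%E) (M : set nat)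
  (r : R) (x : lp p1) : 0 < r -> r <= `|restr M x| ->
  `|restr M (metric_proj (cylinder M r) x)| = r.
Proof.
move=> r0 rx; have [Cy yP] := metric_proj_cylinderP M x r0.
apply/eqP; rewrite eq_le; apply/andP; split=> //.
have [y [Cz xyE _]] := cylinder_nearest r0 rx.
have := yP _ Cz; rewrite xyE => h.
have := le_trans (norm_restr_le M _) h; rewrite restrB => /(le_trans (lerB_dist _ _)).
by rewrite lerBlDr -addrA; rewrite lerDl addrC subr_ge0.
Qed.

Lemma cylinder_interior (R : realType) (s : R) (p1 : (1 <= s%:E)%E) (M : set nat)
  (r : R) (x : lp p1) : `|restr M x| < r -> (cylinder M r)° x.
Proof.
move=> xr; apply/nbhs_normP; exists (r - `|restr M x|) => /=; first by rewrite subr_gt0.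
move=> u /= xu; rewrite /cylinder/=.
rewrite -[u](subrK x) restrD (le_trans (ler_normD _ _))// -lerBrDr.
by rewrite (le_trans (norm_restr_le _ _))// distrC ltW.
Qed.

(** * Coderivatives and covering constants *)

Lemma coderivative_near_id (R : realType) (p : \bar R) (p1 : (1 <= p)%E)
    (f : lp p1 -> lp p1) (x : lp p1) (w : dual_lp p1) :
  (\forall u \near x, f u = u) -> coderivative f x x w w.
Proof.
move=> fx; have fxx : f x = x by exact: (nbhs_singleton fx).
split=> //; apply: limf_esup_le; apply: nbhs_dnbhs; apply: filterS fx => u fu.
by rewrite fu fxx subrr mul0r.
Qed.

(** Along u = x + t e_i, with t small and of the sign of z_i - w_i, the quotient
has the constant value |z_i - w_i| / (2 |e_i|); an upper limit at most 0 thus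
forces z_i = w_i. *)
Lemma coderivative_near_id_eq (R : realType) (s : R) (p1 : (1 <= s%:E)%E)
    (f : lp p1 -> lp p1) (x y : lp p1) (w z : dual_lp p1) :
  (\forall u \near x, f u = u) -> coderivative f x y w z -> z = w.
Proof.
move=> fx [_ limle]; have fxx : f x = x by exact: (nbhs_singleton fx).
apply/LfuneqP => i; apply/eqP; rewrite -subr_eq0; apply/negP => /negP zw.
have s0 : 0 < s by rewrite (lt_le_trans ltr01)// -lee_fin.
pose e : lp p1 := Lfun_Sub p1 (unit_seq_Lfun i s0).
have e0 : 0 < `|e|.
  rewrite normr_gt0; apply/eqP => e0.
  have : e i = 0 by rewrite e0.
  by rewrite /= eqxx => /eqP; rewrite oner_eq0.
have c0 : 0 < `|z i - w i| / (2 * `|e|).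
  by rewrite divr_gt0 ?normr_gt0// mulr_gt0.
have /limf_esup_lt : (limf_esup (fun u : lp p1 =>
    ((pairing z (u - x) - pairing w (f u - f x)) /
     (`|u - x| + `|f u - f x|))%:E) x^' < (`|z i - w i| / (2 * `|e|))%:E)%E.
  by apply: le_lt_trans limle _; rewrite lte_fin.
rewrite /dnbhs /within /= => h.
have [d /= d0 dP] := (nbhs_normP _ _).1 (filterI fx h).
pose t := Num.sg (z i - w i) * (d / (2 * `|e|)).
have tN : `|t| = d / (2 * `|e|).
  rewrite normrM normr_sg zw mul1r ger0_norm// divr_ge0 ?mulr_ge0//.
  exact: ltW.
have t0 : t != 0 by rewrite -normr_gt0 tN divr_gt0// mulr_gt0.
have [|/= fu /(_ _)/wrap[|]] := dP (x + t *: e).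
- rewrite /= opprD addrA subrr add0r normrN normrZ tN.
  by rewrite invfM mulrA divfK ?gt_eqF// ltr_pdivrMr// ltr_pMr// ltr1n.
- rewrite -subr_eq0 addrC addKr scaler_eq0 negb_or t0 /=.
  by rewrite -normr_gt0.
- rewrite fu fxx [x + _]addrC addrK.
  have tE k : (t *: e) k = t * (k == i)%:R by [].
  rewrite !(pairing_unit _ tE) lte_fin normrZ tN -mulrBr.
  rewrite (_ : t * (z i - w i) = `|z i - w i| * (d / (2 * `|e|))); last first.
    by rewrite /t mulrAC -normrEsg.
  suff -> : `|z i - w i| * (d / (2 * `|e|)) /
      (d / (2 * `|e|) * `|e| + d / (2 * `|e|) * `|e|) =
      `|z i - w i| / (2 * `|e|) by rewrite ltxx.
  by field; rewrite gt_eqF//= gt_eqF// addr_gt0.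
Qed.

(** The sequence space is nonzero, so functionals of norm 1 exist and the infima
are not taken over the empty set: this is the upper bound 1. For the lower bound
it suffices to use a radius for which f is the identity around every point of
the ball. *)
Lemma covering_constant_near_id (R : realType) (s : R) (s1 : 1 < s)
    (p1 : (1 <= s%:E)%E) (f : lp p1 -> lp p1) (xbar : lp p1) :
  (\forall u \near xbar, f u = u) -> covering_constant f xbar (f xbar) = 1%E.
Proof.
move=> fid; have s0 : 0 < s by rewrite (lt_trans ltr01).
have fxx : f xbar = xbar by exact: (nbhs_singleton fid).
pose e : lp p1 := Lfun_Sub p1 (unit_seq_Lfun 0 s0).
have e0 : e != 0.
  apply/eqP => e0; have : e 0%N = 0 by rewrite e0.
  by move=> /= /eqP; rewrite oner_eq0.
have [w [w1 _ _]] := supporting_functional s1 e0.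
apply/eqP; rewrite eq_le; apply/andP; split.
- apply: ge_ereal_sup => _ [eta /= eta0 <-]; apply: ge_ereal_inf.
  exists 1%E => //; exists xbar, (f xbar), w, w; split=> //.
  + exact: closed_ballxx.
  + by split=> //; exact: closed_ballxx.
  + by rewrite fxx; exact: coderivative_near_id.
  + by rewrite w1.
- have [d /= d0 dP] := (nbhs_normP _ _).1 fid.
  apply: le_ereal_sup_tmp; eexists; first by exists (d / 2) => //=; rewrite divr_gt0.
  apply: le_ereal_inf_tmp => _ [x [y [w' [z [xd _ w'1 dxy ->]]]]].
  suff -> : z = w' by rewrite w'1.
  apply: coderivative_near_id_eq dxy.
  move: xd; rewrite closed_ballE ?divr_gt0// /closed_ball_/= => xd.
  apply/nbhs_normP; exists (d / 2) => /=; first by rewrite divr_gt0.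
  move=> u /= ux; apply: dP => /=.
  rewrite (le_lt_trans (ler_distD x _ _))//.
  by rewrite [ltRHS](splitr d) ler_ltD.
Qed.

Lemma covering_constant_ge0 (R : realType) (p : \bar R) (p1 : (1 <= p)%E)
    (f : lp p1 -> lp p1) (x y : lp p1) : (0 <= covering_constant f x y)%E.
Proof.
apply: le_ereal_sup_tmp; eexists; first by exists 1 => //=.
by apply: le_ereal_inf_tmp => _ [? [? [? [z [_ _ _ _ ->]]]]]; rewrite lee_fin.
Qed.

(** If w is minimized over the range of f at f x, then 0 lies in the coderivative
of f at w, however f behaves near x. *)
Lemma covering_constant_supported (R : realType) (p : \bar R) (p1 : (1 <= p)%E)
    (f : lp p1 -> lp p1) (x : lp p1) (w : dual_lp p1) :
  `|w| = 1 -> (forall u, 0 <= pairing w (f u - f x)) ->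
  covering_constant f x (f x) = 0%E.
Proof.
move=> w1 fw; apply/eqP; rewrite eq_le covering_constant_ge0 andbT.
apply: ge_ereal_sup => _ [eta /= eta0 <-]; apply: ge_ereal_inf.
exists 0%E => //; exists x, (f x), w, 0; split=> //.
- exact: closed_ballxx.
- by split=> //; exact: closed_ballxx.
- split=> //; apply: limf_esup_le; apply: nearW => u.
  by rewrite pairing0 sub0r lee_fin mulr_le0_ge0 ?oppr_le0 ?invr_ge0 ?addr_ge0.
- by rewrite normr0.
Qed.

Theorem theorem4p1 (R : realType) (p : \bar R) (p1 : (1 < p)%E)
    (py : (p < +oo)%E) (M : set nat) (M0 : M !=set0) (r : R) (r0 : 0 < r)
    (xbar ybar : lp (ltW p1)) :
  let C : set (lp (ltW p1)) := cylinder M r in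
  ybar = metric_proj C xbar ->
  (C° xbar -> covering_constant (metric_proj C) xbar ybar = 1%E) /\
  (~ C° xbar -> covering_constant (metric_proj C) xbar ybar = 0%E).
Proof.
case: p p1 py xbar ybar => [s p1 _ xbar ybar C ->||]//.
have s1 : 1 < s by rewrite -lte_fin.
split=> [xC|xNC].
  apply: covering_constant_near_id => //.
  by apply: filterS xC => u Cu; exact: metric_proj_id.
have rx : r <= `|restr M xbar|.
  by rewrite leNgt; apply/negP => /cylinder_interior.
have yr := norm_restr_metric_proj r0 rx.
have v0 : restr M (metric_proj C xbar) != 0 by rewrite -normr_gt0 yr.
have [w [w1 wsupp wP]] := supporting_functional s1 v0.
apply: (covering_constant_supported w1) => u.
have [Cu _] := metric_proj_cylinderP M u r0.
(* As w vanishes outside M, it sees only the part of P u - P xbar inside M. *)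
have := wP (restr M (metric_proj C u)).
rewrite yr => /(_ Cu).
rewrite -restrB pairing_restr// => k kM.
by apply: wsupp; rewrite restrE (negbTE kM).
Qed.
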